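(* Let $X,Y\subseteq\mathsf{all}$ be such that $X\neq\emptyset$ and for all $x\in X$ there is $y\in Y$ with $y\ne x$. If $\mathsf{osc}\in X$ or $\mathsf{osc}\notin Y$, then $(2^\omega,\mathcal M,\in)\le_T(D_X,\mathrm{Sym}(\omega),R_Y)$.
   Context: Relational systems: a relational system is a triple $\mathcal A=(A_-,A_+,A)$ with $A\subseteq A_-\times A_+$ such that for every $a_-\in A_-$ there is $a_+\in A_+$ with $a_-\,A\,a_+$, and for every $a_+\in A_+$ there is $a_-\in A_-$ for which $a_-\,A\,a_+$ fails. $\mathcal A\le_T\mathcal B$ (Tukey reducibility), for $\mathcal B=(B_-,B_+,B)$, means that there are functions $\varphi_-:A_-\to B_-$ and $\varphi_+:B_+\to A_+$ such that for all $a_-\in A_-$, $b_+\in B_+$: $\varphi_-(a_-)\,B\,b_+$ implies $a_-\,A\,\varphi_+(b_+)$. Density: $n\in\omega$ is identified with $\{0,\dots,n-1\}$. For $A\subseteq\omega$, $\underline d(A)=\liminf_n|A\cap n|/n$ and $\overline d(A)=\limsup_n|A\cap n|/n$; if they are equal, $d(A)$ denotes the common value; if $\underline d(A)<\overline d(A)$, write $d(A)=\mathsf{osc}$, where $\mathsf{osc}$ is a formal symbol. $\mathsf{all}=[0,1]\cup\{\mathsf{osc}\}$. $\mathrm{Sym}(\omega)$ is the set of permutations of $\omega$. $D_X$ is the collection of infinite-coinfinite sets $A\subseteq\omega$ with $d(A)\in X$. For $A\in D_X$ and $\pi\in\mathrm{Sym}(\omega)$, $A\,R_Y\,\pi$ means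 $d(\pi[A])\in Y$ and $d(\pi[A])\ne d(A)$. $\mathcal M$ is the ideal of meager subsets of the Cantor space $2^\omega$; in $(2^\omega,\mathcal M,\in)$, $x$ is related to $M$ iff $x\in M$. *)

(* Defs.v *)
From HB Require Import structures.
From mathcomp Require Import all_boot all_order all_algebra.
From mathcomp Require Import all_classical all_reals all_analysis.
Import Order.TTheory GRing.Theory Num.Theory.
Import numFieldNormedType.Exports.

Set Implicit Arguments.
Unset Strict Implicit.
Unset Printing Implicit Defensive.

Local Open Scope classical_set_scope.
Local Open Scope ring_scope.

(* A triple (A_-, A_+, A); the two nontriviality conditions are kept apart in
   [relational_system]. *)
Record rel_triple := RelTriple {
  minus : Type;
  plus : Type;
  related : minus -> plus -> Prop }.

Definition relational_system (A : rel_triple) : Prop :=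
  (forall a : minus A, exists b : plus A, related a b) /\
  (forall b : plus A, exists a : minus A, ~ related a b).

Definition tukey_le (A B : rel_triple) : Prop :=
  exists (phim : minus A -> minus B) (phip : plus B -> plus A),
    forall (a : minus A) (b : plus B),
      related (phim a) b -> related a (phip b).

Definition nowhere_dense (T : topologicalType) (A : set T) : Prop :=
  interior (closure A) = set0.

Definition meager (T : topologicalType) : set (set T) :=
  [set M | exists2 F : (set T)^nat,
     (forall n, nowhere_dense (F n)) & M = \bigcup_n F n].

Definition cantor_meager : rel_triple :=
  @RelTriple cantor_space (set_type (@meager cantor_space))
    (fun x M => (val M : set cantor_space) x).

Section Density.
Variable R : realType.

(* |A ∩ n| / n; the junk value at n = 0 does not affect liminf and limsup. *)
Definition density_ratio (A : set nat) : R^nat :=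
  fun n => #|[pred i : 'I_n | (i : nat) \in A]|%:R / n%:R.

Definition lower_density (A : set nat) : R := limn_inf (density_ratio A).
Definition upper_density (A : set nat) : R := limn_sup (density_ratio A).

Inductive dval := Dens of R | Osc.

Definition dall : set dval := Dens @` `[0, 1] `|` [set Osc].

Definition density (A : set nat) : dval :=
  if lower_density A == upper_density A then Dens (lower_density A) else Osc.

Definition dsets (X : set dval) : set (set nat) :=
  [set A | [/\ infinite_set A, infinite_set (~` A) & X (density A)]].

Definition rearranges (Y : set dval) (A : set nat) (p : nat -> nat) : Prop :=
  Y (density (p @` A)) /\ density (p @` A) <> density A.

End Density.

Arguments Osc {R}.
Arguments dall {R}.

Definition sym_nat : set (nat -> nat) := [set p | bijective p].

Definition density_system (R : realType) (X Y : set (dval R)) : rel_triple :=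
  @RelTriple (set_type (dsets X)) (set_type sym_nat)
    (fun A p => rearranges Y (val A) (val p)).

(* Main.v *)
Require Import Defs.
From mathcomp Require Import all_boot all_order all_algebra.
From mathcomp Require Import all_classical all_reals all_analysis.
From mathcomp Require Import zify lra.
Import Order.TTheory GRing.Theory Num.Theory.
Import numFieldNormedType.Exports.

Set Implicit Arguments.
Unset Strict Implicit.
Unset Printing Implicit Defensive.

Local Open Scope classical_set_scope.

(** Fix a value [v] in [X], equal to [Osc] when [X] contains [Osc], and a set
    [B] of density [v].  A point [x] of the Cantor space colours the natural
    numbers with two colours; [shuffle x B] places a copy of [B] along each
    colour class.  The map sending [x] to [shuffle x B] (or to [B], should the
    shuffle leave [D_X]) is the first half of the Tukey reduction, and a
    permutation [p] is sent to the set of all [x] whose image is rearranged by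
    [p] as [Y] requires.  Everything rests on this set being meager.

    Suppose that [x] is known below [n] only, and let [m] be arbitrary.  Beyond
    [n], give colour [true] to exactly the points that [p] sends below [m]
    ([shuffle_imitation]).  Up to an error bounded in terms of [n] alone, the
    points of [p @` shuffle x B] below [m] then are as many as those of [B]
    below [m].  Choosing [m] large, among the places where the ratio of [B] is
    close to its lower, respectively upper, density, one sees that for generic
    [x] the lower density of [p @` shuffle x B] is at most that of [B] and the
    upper density at least that of [B] ([meager_density_escape]).  So a generic
    rearrangement has density [v] or oscillates ([density_squeezed]).  The set
    [shuffle x B] has density [v] itself: for real [v] because a mixture of two
    copies of [B] inherits its density ([cvg_ratio_shuffle]), for [v = Osc] by
    genericity with [p] the identity.  Hence a rearrangement with another
    density in [Y] must oscillate while [v] is real; but then [X] does not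
    contain [Osc], so neither does [Y].

    That both triples are relational systems follows from the Baire category
    theorem for the Cantor space ([cantor_baire]), from the existence of
    infinite-coinfinite sets of every density ([exists_density_base]), and from
    the fact that any such set can be permuted onto any other
    ([permutation_onto]).  That no permutation answers every set in [D_X] is
    inherited from the Cantor space through the Tukey reduction. *)

(** * Counting initial segments *)

Section Counting.
Local Open Scope nat_scope.

Definition initial_count (P : pred nat) n := count P (iota 0 n).

Lemma initial_countS P n : initial_count P n.+1 = initial_count P n + P n.
Proof. by rewrite /initial_count -addn1 iotaD count_cat /= addn0. Qed.

Lemma initial_count_le P n : initial_count P n <= n.
Proof. by rewrite -[leqRHS](size_iota 0); exact: count_size. Qed.

Lemma initial_count_lip P k l :
  k <= l -> initial_count P k <= initial_count P l <= initial_count P k + (l - k).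
Proof.
move=> /subnKC <-; elim: (l - k) => [|d]; first by rewrite addn0 subnn; lia.
by rewrite addnS initial_countS !addKn; case: (P _); lia.
Qed.

Lemma initial_count_agree (P Q : pred nat) N M :
    (forall i, N <= i < M -> P i = Q i) ->
  initial_count P M <= initial_count Q M + N.
Proof.
elim: M => [//|M IH] PQ; have [MN|NM] := leqP M.+1 N.
  by apply: leq_trans (initial_count_le _ _) _; lia.
rewrite !initial_countS (PQ M) ?ltnSn ?andbT//.
by have := IH (fun i Hi => PQ i ltac:(lia)); lia.
Qed.

(** A permutation only relabels what it counts: the points of [p @` A] below [m]
    are counted on the source side, where they are spread over all of [M]. *)
Lemma initial_count_image (A : set nat) (p : nat -> nat) m M :
    bijective p -> (forall i, p i < m -> i < M) ->
  initial_count (fun k => k \in p @` A) m =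
  initial_count (fun i => (p i < m) && (i \in A)) M.
Proof.
move=> bp pM; have pinj := bij_inj bp; rewrite /initial_count -!size_filter.
rewrite -[RHS](size_map p).
apply/perm_size/uniq_perm; rewrite ?(map_inj_uniq pinj) ?filter_uniq ?iota_uniq//.
move=> k; rewrite mem_filter mem_iota /= add0n; apply/andP/mapP => [[]|[i]].
  rewrite inE => -[i Ai <-] pim; exists i => //.
  by rewrite mem_filter pim mem_iota /= (pM _ pim) andbT inE.
rewrite mem_filter => /andP[/andP[pim Ai] _] ->; split=> //.
by rewrite inE; exists i => //; rewrite inE in Ai.
Qed.

Lemma infinite_unbounded_count (A : set nat) :
  (forall K, exists n, K <= initial_count (fun k => k \in A) n) -> infinite_set A.
Proof.
move=> big fin; have [N AN] : exists N, forall i, A i -> i < N.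
  have [s As] := (finite_seqP _).1 fin.
  exists (\max_(i <- s) i).+1 => i; rewrite As /= ltnS => si.
  exact: (leq_bigmax_seq (F := id)).
have [n] := big N.+1; apply/negP; rewrite -ltnNge ltnS.
have := @initial_count_agree (fun k => k \in A) pred0 N n.
rewrite {2}/initial_count count_pred0; apply=> i /andP[Ni _].
by apply/negbTE/negP; rewrite inE => /AN; lia.
Qed.

Lemma initial_countC (A : set nat) n :
  initial_count (fun k => k \in ~` A) n = n - initial_count (fun k => k \in A) n.
Proof.
rewrite -{2}(size_iota 0 n) -(count_predC (fun k => k \in A)) addKn.
by apply: eq_count => k /=; rewrite in_setC.
Qed.

(** This reduces the construction of a set with prescribed density to that of a
    function with steps 0 and 1. *)
Lemma initial_count_step (t : nat -> nat) n : t 0 = 0 ->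
  (forall i, t i <= t i.+1 <= (t i).+1) ->
  initial_count (fun k => k \in [set i | t i < t i.+1]) n = t n.
Proof.
move=> t0 tS; elim: n => // n IH; rewrite initial_countS IH.
have := tS n; have [tn|tn] := ltnP (t n) (t n.+1).
  by rewrite mem_set//=; lia.
by rewrite memNset/=; lia.
Qed.

Lemma initial_count_const P b n d : (forall i, n <= i < n + d -> P i = b) ->
  initial_count P (n + d) = initial_count P n + b * d.
Proof.
elim: d => [|d IH] Pb; first by rewrite addn0 muln0 addn0.
rewrite addnS initial_countS IH => [|i ?]; last by apply: Pb; lia.
by rewrite Pb; lia.
Qed.

End Counting.

(** * Shuffling a set along a two-colouring *)

Section Shuffle.
Local Open Scope nat_scope.

Definition color_count (x : nat -> bool) c := initial_count (fun i => x i == c).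

Definition color_rank (x : nat -> bool) i := color_count x (x i) i.

(** The elements of one colour, listed in increasing order, are treated as a
    copy of the natural numbers, inside which a copy of [B] is taken. *)
Definition shuffle (x : nat -> bool) (B : set nat) : set nat := color_rank x @^-1` B.

Lemma color_countS x c n : color_count x c n.+1 = color_count x c n + (x n == c).
Proof. exact: initial_countS. Qed.

Lemma color_countD x n : color_count x true n + color_count x false n = n.
Proof. by elim: n => // n IH; rewrite !color_countS; case: (x n); lia. Qed.

(** One of the two colours is used more than [k] times among the first
    [2k + 1] numbers; the rank [k] occurs within that colour. *)
Lemma color_rank_surj x k : exists i, color_rank x i = k.
Proof.
have hit c n : k < color_count x c n -> exists i, color_rank x i = k.
  elim: n => // n IH; rewrite color_countS; case: eqP => [xn|_] /=; last first.
    by rewrite addn0.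
  rewrite addn1 ltnS leq_eqVlt => /predU1P[->|]; first by exists n; rewrite /color_rank xn.
  exact: IH.
have := color_countD x k.*2.+1.
have [/hit//|+ D] := ltnP k (color_count x true k.*2.+1).
by move=> ?; apply: (hit false k.*2.+1); lia.
Qed.

(** Since the complement of a shuffle is definitionally the shuffle of the
    complement, this also gives coinfiniteness. *)
Lemma infinite_shuffle x B : infinite_set B -> infinite_set (shuffle x B).
Proof.
move=> Binf fin; apply: Binf; apply: sub_finite_set (finite_image (color_rank x) fin).
by move=> k Bk; have [i ik] := color_rank_surj x k; exists i => //; rewrite /shuffle/= ik.
Qed.

Lemma initial_count_shuffle_color x B c n :
  initial_count (fun i => (x i == c) && (i \in shuffle x B)) n =
  initial_count (fun k => k \in B) (color_count x c n).
Proof.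
elim: n => // n IH; rewrite initial_countS IH color_countS.
case: eqP => [<-|_] /=; last by rewrite !addn0.
by rewrite addn1 initial_countS; congr (_ + _).
Qed.

Lemma initial_count_shuffle x B n :
  initial_count (fun i => i \in shuffle x B) n =
  initial_count (fun k => k \in B) (color_count x true n) +
  initial_count (fun k => k \in B) (color_count x false n).
Proof.
rewrite -!initial_count_shuffle_color; elim: n => // n IH.
by rewrite !initial_countS IH; case: (x n) => /=; case: (_ \in _); lia.
Qed.

Definition agree (n : nat) (x y : nat -> bool) := forall i, i < n -> x i = y i.

(** The extension [y] of [x] below [N] colours [true] just the points sent below
    [m] by [p].  All these points lie below some [M], and between [N] and [M]
    the part of the shuffle that [p] sends below [m] is its part of colour
    [true].  The elements of colour [true] below [M] number [m] up to [N], and they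
    carry a copy of the corresponding initial segment of [B].  Each of the two
    comparisons costs an error of at most [N]. *)
Lemma shuffle_imitation (p : nat -> nat) x B N m : bijective p ->
  exists y, agree N x y /\ exists M, forall z, agree M y z ->
    initial_count (fun k => k \in B) m <=
      initial_count (fun k => k \in p @` shuffle z B) m + N.*2 /\
    initial_count (fun k => k \in p @` shuffle z B) m <=
      initial_count (fun k => k \in B) m + N.*2.
Proof.
move=> bp; have [q pK qK] := bp.
pose M := (\max_(k < m) q k).+1.
have pM i : p i < m -> i < M.
  by move=> h; rewrite ltnS -(pK i); exact: (leq_bigmax (Ordinal h)).
exists (fun i => if i < N then x i else p i < m); split; first by move=> i ->.
exists M => z yz.
have zE i : N <= i < M -> z i = (p i < m).
  by move=> /andP[Ni iM]; rewrite -yz// ltnNge Ni.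
rewrite (initial_count_image _ bp pM).
have imC : initial_count (fun i => p i < m) M = m.
  rewrite -[RHS](_ : initial_count (fun k => k \in p @` [set: nat]) m = m).
    by rewrite (initial_count_image _ bp pM); apply: eq_count => i; rewrite in_setT andbT.
  rewrite -{2}(size_iota 0 m); apply/eqP; rewrite -all_count; apply/allP => k _ /=.
  by rewrite inE; exists (q k).
pose P i := (p i < m) && (i \in shuffle z B).
pose Q i := (z i == true) && (i \in shuffle z B).
have PQ i : N <= i < M -> P i = Q i by move=> h; rewrite /P /Q zE// eqb_id.
have h1 := initial_count_agree PQ.
have h2 := initial_count_agree (fun i h => esym (PQ i h)).
have cE i : N <= i < M -> (p i < m) = (z i == true) by move=> h; rewrite zE// eqb_id.
have h3 := initial_count_agree cE.
have h4 := initial_count_agree (fun i h => esym (cE i h)).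
rewrite imC in h3 h4; rewrite -/P; rewrite /Q initial_count_shuffle_color in h1 h2.
have := @initial_count_lip (fun k => k \in B) m (color_count z true M).
have := @initial_count_lip (fun k => k \in B) (color_count z true M) m.
move: h1 h2 h3 h4; rewrite -/(color_count z true M) -addnn.
move: (initial_count P M) (initial_count _ m) (initial_count _ (color_count _ _ _)).
by move: (color_count _ _ _) => c; case: (leqP c m); lia.
Qed.

End Shuffle.

(** * Category in the Cantor space *)

Section Category.
Local Open Scope nat_scope.

Lemma agree_nbhs n (x : cantor_space) : nbhs x [set y : cantor_space | agree n x y].
Proof.
elim: n => [|n IH]; first by apply: filterS filterT => y _ i.
have : nbhs x ([set y : cantor_space | agree n x y] `&`
               proj n @^-1` [set x n]).
  by apply: filterI => //; apply: (@proj_continuous _ (fun=> bool) n x); exact: discrete_set1.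
apply: filterS => y [xy /= xyn] i; rewrite ltnS leq_eqVlt => /predU1P[->//|].
exact: xy.
Qed.

(** Otherwise points agreeing with [x] on longer and longer initial segments
    could be chosen outside [U], although they converge to [x]. *)
Lemma nbhs_agree (x : cantor_space) U :
  nbhs x U -> exists n, [set y : cantor_space | agree n x y] `<=` U.
Proof.
move=> xU; apply: contrapT => /forallNP H.
have {}H n : exists y : cantor_space, agree n x y /\ ~ U y.
  by have /existsNP[y /not_implyP] := H n; exists y.
have [g gP] := choice H.
have gx : g @ \oo --> x.
  apply/cvg_sup => N V [W] [[Z] oZ <-] ZxN ZV.
  by apply: (filterS ZV); rewrite nbhs_simpl; exists N.+1 => // i /= Ni; rewrite -(gP i).1.
have [N _ gU] : \forall n \near \oo, U (g n) by exact: gx.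
by have [_] := gP N; apply; apply: gU => /=.
Qed.

(** The combinatorial form in which the later category arguments are carried
    out; a point together with a length serves as a finite condition. *)
Lemma nowhere_denseP (F : set cantor_space) :
  nowhere_dense F <->
  forall (x : cantor_space) n, exists y : cantor_space, agree n x y /\
    exists m, forall z : cantor_space, agree m y z -> ~ F z.
Proof.
split=> [F0 x n|H].
  apply: contrapT => /forallNP H.
  suff : interior (closure F) x by rewrite F0.
  apply: filterS (agree_nbhs n x) => y xy U /nbhs_agree [m yU].
  have /not_andP[//|/forallNP/(_ m)/existsNP[z /not_implyP[yz /contrapT Fz]]] := H y.
  by exists z; split => //; exact: yU.
rewrite /nowhere_dense -subset0 => x /nbhs_agree[n xF].
have [y [xy [m yF]]] := H x n.
by have [z [Fz yz]] := xF _ xy _ (agree_nbhs m y); exact: yF yz Fz.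
Qed.

Lemma nowhere_dense_subset (T : topologicalType) (A B : set T) :
  A `<=` B -> nowhere_dense B -> nowhere_dense A.
Proof.
by move=> AB; rewrite /nowhere_dense -!subset0; apply: subset_trans; exact/interiorS/closureS.
Qed.

Lemma meager_subset (T : topologicalType) (A B : set T) : A `<=` B -> meager B -> meager A.
Proof.
move=> AB [F F0 BF]; exists (fun n => A `&` F n).
  by move=> n; apply: nowhere_dense_subset (F0 n) => x [].
by rewrite -setI_bigcupr -BF setIidl.
Qed.

Lemma meager_bigcup (T : topologicalType) (I : countType) (M : I -> set T) :
  (forall i, meager (M i)) -> meager (\bigcup_i M i).
Proof.
move=> Mm.
have /choice[F FP] : forall i, exists G : nat -> set T,
    (forall n, nowhere_dense (G n)) /\ M i = \bigcup_n G n.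
  by move=> i; have [G ? ?] := Mm i; exists G.
exists (fun k => if unpickle k is Some (i, n) then F i n else set0).
  move=> k; case: (unpickle k) => [[i n]|]; first exact: (FP i).1.
  by rewrite /nowhere_dense closure0 interior0.
rewrite eqEsubset; split => x [].
  move=> i _; rewrite (FP i).2 => -[n _ Fx].
  by exists (pickle (i, n)) => //; rewrite pickleK.
move=> k _; case: (unpickle k) => [[i n]|//] Fx.
by exists i => //; rewrite (FP i).2; exists n.
Qed.

Lemma nowhere_dense_meager (T : topologicalType) (A : set T) : nowhere_dense A -> meager A.
Proof. by move=> A0; exists (fun=> A) => //; rewrite bigcup_const//; exists 0. Qed.

Lemma meager_set1 (x : cantor_space) : meager [set x].
Proof.
apply: nowhere_dense_meager; apply/nowhere_denseP => y n.
(* Disagreeing with [x] at [n] already leaves the singleton. *)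
exists (fun i => if i < n then y i else ~~ x i); split; first by move=> i ->.
exists n.+1 => z /(_ n (ltnSn n)); rewrite ltnn => yz zx.
by move: yz; rewrite zx; case: (x n).
Qed.

(** The finite conditions avoiding [F 0], [F 1] and so on are extended one after
    the other; the point that they determine lies in none of these sets. *)
Lemma cantor_baire (M : set cantor_space) : meager M -> exists x, ~ M x.
Proof.
case=> F F0 ->.
have step (k : nat) (s : cantor_space * nat) : exists t : cantor_space * nat,
    [/\ agree s.2 s.1 t.1, s.2 < t.2 & forall z, agree t.2 t.1 z -> ~ F k z].
  have [y [xy [m yF]]] := (nowhere_denseP (F k)).1 (F0 k) s.1 s.2.
  exists (y, maxn m s.2.+1); split => //=; first lia.
  by move=> z yz; apply: yF => i im; apply: yz; lia.
have [next nextP] := choice (fun ks : nat * (cantor_space * nat) => step ks.1 ks.2).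
pose fix s k : cantor_space * nat :=
  if k is k'.+1 then next (k', s k') else (point, 0).
have sP k : [/\ agree (s k).2 (s k).1 (s k.+1).1, (s k).2 < (s k.+1).2 &
    forall z, agree (s k.+1).2 (s k.+1).1 z -> ~ F k z] by exact: nextP (k, s k).
have s_ge k : k <= (s k).2.
  by elim: k => // k IH; have [_ + _] := sP k; exact: leq_ltn_trans.
have s_agree k d : agree (s k).2 (s k).1 (s (k + d)).1 /\ (s k).2 <= (s (k + d)).2.
  elim: d => [|d [IH1 IH2]]; first by rewrite addn0.
  have [h1 h2 _] := sP (k + d); rewrite addnS; split; last lia.
  by move=> i ik; rewrite IH1// h1//; lia.
(* From stage [i.+1] on, the coordinate [i] never changes: the condition reached
   there has length more than [i]. *)
pose x : cantor_space := fun i => (s i.+1).1 i.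
exists x => -[k _ Fx]; have [_ _] := sP k; apply; last exact: Fx.
move=> i ik; have := s_ge i.+1; rewrite /x => ige.
have [h|h] := leqP k.+1 i.+1.
  by have := (s_agree k.+1 (i - k)).1 i ik; rewrite (_ : k.+1 + (i - k) = i.+1)//; lia.
have := (s_agree i.+1 (k - i)).1 i ige; rewrite (_ : i.+1 + (k - i) = k.+1)//; last lia.
Qed.

Lemma cantor_meager_relational : relational_system cantor_meager.
Proof.
split=> [x|M]; first by exists (SigSub (mem_set (meager_set1 x))).
by have [x xM] := cantor_baire (set_valP M); exists x.
Qed.

End Category.

Local Open Scope ring_scope.

(** * Limits inferior and superior of bounded sequences *)

Section LimInfSup.
Variable R : realType.
Implicit Types (u : R^nat) (a : R).

Lemma limn_inf_leP u a : has_ubound (range u) -> has_lbound (range u) ->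
  limn_inf u <= a <-> forall e : R, 0 < e -> forall N, exists2 n, (N <= n)%N & u n <= a + e.
Proof.
move=> uu ul; have -> : limn_inf u = sup (range (infs u)).
  exact/cvg_lim/cvg_infs_sup.
split=> [supa e e0 N|H].
  apply: contrapT => nu.
  have {}nu n : (N <= n)%N -> a + e <= u n.
    by move=> Nn; rewrite leNgt; apply/negP => un; apply: nu; exists n => //; exact: ltW.
  suff : a + e <= a by rewrite gerDl leNgt e0.
  apply: le_trans supa; apply: le_trans (_ : infs u N <= _).
    by apply: lb_le_inf; [by exists (u N); exists N => /=|move=> _ [n Nn <-]; exact: nu].
  apply: ub_le_sup; last by exists N => /=.
  case: uu => M uM; exists M => _ [n _ <-].
  rewrite (@le_trans _ _ (u n)) //; last by apply: uM; exists n.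
  by apply: ge_inf; [exact/has_lbound_sdrop|exists n => /=].
apply: ge_sup; first by exists (infs u 0); exists 0.
move=> _ [n _ <-]; apply/ler_addgt0Pr => e e0.
have [m nm um] := H e e0 n; apply: le_trans um.
by apply: ge_inf; [exact/has_lbound_sdrop|exists m => /=].
Qed.

Lemma limn_infN_bounded u : has_ubound (range u) -> has_lbound (range u) ->
  limn_inf (-%R \o u) = - limn_sup u.
Proof.
move=> uu ul; rewrite /limn_inf infsN limN//.
by apply/cvg_ex; exists (inf (range (sups u))); exact: cvg_sups_inf.
Qed.

Lemma limn_sup_geP u a : has_ubound (range u) -> has_lbound (range u) ->
  a <= limn_sup u <-> forall e : R, 0 < e -> forall N, exists2 n, (N <= n)%N & a - e <= u n.
Proof.
move=> uu ul; rewrite -lerN2 -limn_infN_bounded//.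
rewrite limn_inf_leP; first last.
- by move: uu => /has_ub_lbN; rewrite image_comp.
- by move: ul => /has_lb_ubN; rewrite image_comp.
split=> H e e0 N; have [n Nn h] := H e e0 N; exists n => //=; move: h => /=; lra.
Qed.

Lemma limn_inf_le_sup u : has_ubound (range u) -> has_lbound (range u) ->
  limn_inf u <= limn_sup u.
Proof.
move=> uu ul; apply/limn_inf_leP => // e e0 N; apply: contrapT => nu.
have {}nu n : (N <= n)%N -> limn_sup u + e < u n.
  by move=> Nn; rewrite ltNge; apply/negP => un; apply: nu; exists n.
suff : limn_sup u + e <= limn_sup u by rewrite gerDl leNgt e0.
by apply/limn_sup_geP => // d d0 M; exists (maxn M N); rewrite ?leq_maxl//;
  have := nu _ (leq_maxr M N); lra.
Qed.

End LimInfSup.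

(** * Densities of generic shuffles *)

Section Density.
Variable R : realType.
Implicit Types (A B : set nat) (p : nat -> nat).

Notation count A := (initial_count (fun k => k \in (A : set nat))).
Notation ratio := (density_ratio R).

Lemma density_ratioE A n : ratio A n = (count A n)%:R / n%:R.
Proof.
rewrite /density_ratio /initial_count -val_enum_ord count_map cardE size_filter.
by rewrite /enum_mem filter_predT.
Qed.

Lemma density_ratio_ge0 A n : 0 <= ratio A n.
Proof. by rewrite density_ratioE divr_ge0. Qed.

Lemma density_ratio_le1 A n : ratio A n <= 1.
Proof.
rewrite density_ratioE; case: n => [|n]; first by rewrite invr0 mulr0.
by rewrite ler_pdivrMr ?ltr0n// mul1r ler_nat initial_count_le.
Qed.

Lemma density_ratio_ubound A : has_ubound (range (ratio A)).
Proof. by exists 1 => _ [n _ <-]; exact: density_ratio_le1. Qed.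

Lemma density_ratio_lbound A : has_lbound (range (ratio A)).
Proof. by exists 0 => _ [n _ <-]; exact: density_ratio_ge0. Qed.

Lemma lower_density_leP A a : lower_density R A <= a <->
  forall e : R, 0 < e -> forall N, exists2 n, (N <= n)%N & ratio A n <= a + e.
Proof.
by apply: limn_inf_leP; [exact: density_ratio_ubound|exact: density_ratio_lbound].
Qed.

Lemma upper_density_geP A a : a <= upper_density R A <->
  forall e : R, 0 < e -> forall N, exists2 n, (N <= n)%N & a - e <= ratio A n.
Proof.
by apply: limn_sup_geP; [exact: density_ratio_ubound|exact: density_ratio_lbound].
Qed.

Lemma lower_le_upper_density A : lower_density R A <= upper_density R A.
Proof.
by apply: limn_inf_le_sup; [exact: density_ratio_ubound|exact: density_ratio_lbound].
Qed.

Lemma density_cvg A (r : R) : ratio A @ \oo --> r -> density R A = Dens r.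
Proof.
by move=> /cvg_limn_inf_sup[Ar rA]; rewrite /density /lower_density /upper_density Ar rA eqxx.
Qed.

(** Imitation at some [m] that satisfies [P] makes the difference of the ratios at
    most [2n / m], where [n] is the length of the given condition; a large [m]
    brings it below [e]. *)
Lemma nowhere_dense_far B p (P : nat -> Prop) e N : bijective p ->
    (forall K, exists2 m, (K <= m)%N & P m) -> 0 < e ->
  nowhere_dense [set x : cantor_space | forall m, (N <= m)%N -> P m ->
    e < `|ratio (p @` shuffle x B) m - ratio B m|].
Proof.
move=> bp Pinf e0; apply/nowhere_denseP => x n.
have [m Km Pm] := Pinf (maxn N (Num.truncn (n.*2%:R / e)).+1).
move: Km; rewrite geq_max => /andP[Nm Km].
have [y [xy [M yM]]] := shuffle_imitation x B n m bp.
exists y; split => //; exists M => z /yM[h1 h2] /(_ m) far.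
have {far} := far Nm Pm; rewrite !density_ratioE -mulrBl normrM.
have m0 : 0 < m%:R :> R by rewrite ltr0n; apply: leq_trans Km.
rewrite [ `|_^-1| ]gtr0_norm ?invr_gt0// ltr_pdivlMr//.
(* By the choice of [m], it exceeds [2n / e]. *)
suff: `|(count (p @` shuffle z B) m)%:R - (count B m)%:R| <= e * m%:R :> R by lra.
apply: (@le_trans _ _ n.*2%:R).
  rewrite ler_norml lerBrDl lerBlDl; move: h1 h2; rewrite -!(ler_nat R) !natrD.
  by move=> h1 h2; apply/andP; split; lra.
rewrite -ler_pdivrMl// mulrC; apply: ltW.
apply: lt_le_trans (truncnS_gt _) _; by rewrite ler_nat.
Qed.

Lemma exists_inv_lt (e : R) N : 0 < e -> exists2 k, (N <= k)%N & k.+1%:R^-1 <= e.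
Proof.
move=> e0; exists (maxn N (Num.truncn e^-1)); first exact: leq_maxl.
rewrite -[leRHS]invrK lef_pV2 ?posrE ?invr_gt0// ?ltr0n//.
apply: ltW; apply: lt_le_trans (truncnS_gt _) _.
by rewrite ler_nat ltnS leq_maxr.
Qed.

(** Generically the ratio of the rearranged shuffle comes close to that of [B]
    at infinitely many places where the latter is almost its lower density, and
    likewise for the upper density. *)
Lemma meager_density_escape B p : bijective p ->
  meager [set x : cantor_space |
    ~ (lower_density R (p @` shuffle x B) <= lower_density R B /\
       upper_density R B <= upper_density R (p @` shuffle x B))].
Proof.
move=> bp.
pose near_extreme (low : bool) (k : nat) m := if low
  then ratio B m <= lower_density R B + k.+1%:R^-1
  else upper_density R B - k.+1%:R^-1 <= ratio B m.
pose F (i : bool * nat) := [set x : cantor_space | forall m, (i.2 <= m)%N ->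
  near_extreme i.1 i.2 m ->
  i.2.+1%:R^-1 < `|ratio (p @` shuffle x B) m - ratio B m|].
have Fm : meager (\bigcup_i F i).
  apply: meager_bigcup => -[low k]; apply: nowhere_dense_meager.
  have k0 : 0 < k.+1%:R^-1 :> R by rewrite invr_gt0 ltr0n.
  apply: nowhere_dense_far => // N; case: low => /=.
    by apply: (lower_density_leP B _).1.
  by apply: (upper_density_geP B _).1.
apply: meager_subset Fm => x /= esc; apply: contrapT => xF; apply: esc.
have close low k : exists2 m, (k <= m)%N & near_extreme low k m /\
    `|ratio (p @` shuffle x B) m - ratio B m| <= k.+1%:R^-1.
  apply: contrapT => nm; apply: xF; exists (low, k) => // m km Pm /=.
  by rewrite ltNge; apply/negP => far; apply: nm; exists m.
split.
  apply/lower_density_leP => e e0 N.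
  have [|k Nk ke] := exists_inv_lt N (_ : 0 < e / 2); first lra.
  have [m km []] := close true k; rewrite /near_extreme /= => near.
  rewrite ler_norml => /andP[_ h].
  exists m; first exact: leq_trans km.
  move: near h ke; move: (k.+1%:R^-1) (ratio _ m) (ratio _ m) (lower_density _ _).
  by clear=> i u b l near h ke; lra.
apply/upper_density_geP => e e0 N.
have [|k Nk ke] := exists_inv_lt N (_ : 0 < e / 2); first lra.
have [m km []] := close false k; rewrite /near_extreme /= => near.
rewrite ler_norml => /andP[h _].
exists m; first exact: leq_trans km.
move: near h ke; move: (k.+1%:R^-1) (ratio _ m) (ratio _ m) (upper_density _ _).
by clear=> i u b l near h ke; lra.
Qed.

(** If [A] does not oscillate, its density squeezes both densities of [B]. *)
Lemma density_squeezed A B : lower_density R A <= lower_density R B ->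
    upper_density R B <= upper_density R A ->
  density R A = density R B \/ density R A = Osc.
Proof.
move=> lAB uBA; rewrite /density; case: eqP => [eA|]; [left|by right].
have := lower_le_upper_density B; have lBE : lower_density R B = upper_density R B.
  by have := lower_le_upper_density B; lra.
by rewrite lBE eqxx => _; congr Dens; lra.
Qed.

(** If the count of [B] below [k] is [r k] up to [e k / 2 + C], uniformly in [k],
    then adding the counts over the two colour classes gives [r n] up to
    [e n / 2 + 2 C], however the [n] points are divided between the colours. *)
Lemma cvg_ratio_shuffle B x (r : R) :
  ratio B @ \oo --> r -> ratio (shuffle x B) @ \oo --> r.
Proof.
move=> Br; apply/cvgrPdist_le => e e0.
have [K _ BK] : \forall k \near \oo, `|r - ratio B k| <= e / 2.
  by move/cvgrPdist_le : Br; apply; lra.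
pose C := K%:R * (1 + `|r|).
have C0 : 0 <= C by rewrite mulr_ge0// addr_ge0.
have err k : `|r * k%:R - (count B k)%:R| <= e / 2 * k%:R + C.
  have [Kk|kK] := leqP K k.
    case: k Kk => [|k] Kk; first by rewrite !mulr0 /initial_count /= subrr normr0 add0r.
    have := BK k.+1 Kk; rewrite density_ratioE.
    have k0 : 0 < k.+1%:R :> R by rewrite ltr0n.
    rewrite -[r in `|r - _|](mulfK (lt0r_neq0 k0)) -mulrBl normrM.
    rewrite [ `|_^-1| ]gtr0_norm ?invr_gt0// ler_pdivrMr//; lra.
  apply: le_trans (ler_normB _ _) _; rewrite normrM !normr_nat.
  have : (count B k)%:R <= K%:R :> R.
    by rewrite ler_nat (leq_trans (initial_count_le _ _))// ltnW.
  have : `|r| * k%:R <= `|r| * K%:R by rewrite ler_wpM2l// ler_nat ltnW.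
  have : 0 <= e / 2 * k%:R by rewrite mulr_ge0//; lra.
  by rewrite /C mulrDr mulr1 (mulrC K%:R); lra.
near=> n.
have n0 : 0 < n%:R :> R by rewrite ltr0n; near: n; exists 1%N.
rewrite density_ratioE -[r](mulfK (lt0r_neq0 n0)) -mulrBl normrM.
rewrite [ `|_^-1| ]gtr0_norm ?invr_gt0// ler_pdivrMr//.
rewrite initial_count_shuffle natrD.
have nC : 4 * C / e <= n%:R.
  apply: ltW; apply: lt_le_trans (truncnS_gt _) _; rewrite ler_nat.
  by near: n; exists (Num.truncn (4 * C / e)).+1.
rewrite ler_pdivrMr// in nC.
have := err (color_count x true n); have := err (color_count x false n).
have : n%:R = (color_count x true n)%:R + (color_count x false n)%:R :> R.
  by rewrite -natrD color_countD.
set c1 := (color_count x true n)%:R; set c0 := (color_count x false n)%:R => nE.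
rewrite !ler_norml => /andP[h1 h2] /andP[h3 h4].
by rewrite nE !mulrDr; rewrite nE mulrDl in nC; apply/andP; split; lra.
Unshelve. all: by end_near.
Qed.

End Density.

(** * Sets of every density *)

Section OddLog.
Local Open Scope nat_scope.

(** The union of the intervals from [2 ^ k] to [2 ^ k.+1] with [k] odd: its ratio is
    close to 2/3 at [4 ^ j] and to 1/3 at [2 * 4 ^ j]. *)
Definition odd_log_set : set nat := [set i | odd (trunc_log 2 i)].

Lemma mem_odd_log_set k i :
  2 ^ k <= i < 2 ^ k + 2 ^ k -> (i \in odd_log_set) = odd k.
Proof.
move=> ik; apply/idP/idP; rewrite !inE /odd_log_set /= (@trunc_log_eq 2 k)//;
by rewrite expnS; lia.
Qed.

Lemma odd_log_set_count j :
  (initial_count (fun k => k \in odd_log_set) (4 ^ j)) * 3 + 2 = 2 * 4 ^ j /\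
  initial_count (fun k => k \in odd_log_set) (4 ^ j + 4 ^ j) =
  initial_count (fun k => k \in odd_log_set) (4 ^ j).
Proof.
have E k : 4 ^ k = 2 ^ k.*2 by rewrite -mul2n expnM.
have even_step k : initial_count (fun k => k \in odd_log_set) (4 ^ k + 4 ^ k) =
    initial_count (fun k => k \in odd_log_set) (4 ^ k).
  rewrite (@initial_count_const _ false) ?mul0n ?addn0// => i.
  by rewrite E => /mem_odd_log_set ->; rewrite odd_double.
split=> //; elim: j => [|j IH].
  rewrite expn0 /initial_count /=; case: (boolP (0 \in _)) => //.
  by rewrite inE.
have -> : 4 ^ j.+1 = 4 ^ j + 4 ^ j + (4 ^ j + 4 ^ j) by rewrite expnS; lia.
rewrite (@initial_count_const _ true) ?even_step; first lia.
have -> : 4 ^ j + 4 ^ j = 2 ^ j.*2.+1 by rewrite E expnS; lia.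
by move=> i /mem_odd_log_set ->; rewrite /= odd_double.
Qed.

End OddLog.

Section Existence.
Variable R : realType.

Lemma density_odd_log_set : density R odd_log_set = Osc.
Proof.
have low : lower_density R odd_log_set <= 1 / 3.
  apply/lower_density_leP => e e0 N; exists (4 ^ N + 4 ^ N)%N.
    by have := ltn_expl N (isT : 1 < 4)%N; lia.
  rewrite density_ratioE; have [h ->] := odd_log_set_count N.
  have n0 : 0 < (4 ^ N)%:R :> R by rewrite ltr0n expn_gt0.
  rewrite natrD ler_pdivrMr; last lra.
  move/(congr1 (fun n : nat => n%:R : R)) : h; rewrite natrD !natrM.
  have := mulr_ge0 (ltW e0) (ltW n0); lra.
have upp : 1 / 2 <= upper_density R odd_log_set.
  apply/upper_density_geP => e e0 N; exists (4 ^ N.+1)%N.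
    by have := ltn_expl N (isT : 1 < 4)%N; rewrite expnS; lia.
  rewrite density_ratioE; have [h _] := odd_log_set_count N.+1.
  have n0 : 4 <= (4 ^ N.+1)%:R :> R.
    by rewrite ler_nat expnS; have := expn_gt0 4 N; lia.
  rewrite ler_pdivlMr; last lra.
  move/(congr1 (fun n : nat => n%:R : R)) : h; rewrite natrD !natrM.
  have : 0 <= e * (4 ^ N.+1)%:R by rewrite mulr_ge0//; lra.
  lra.
rewrite /density; case: eqP => // E; exfalso; move: upp; rewrite -E; lra.
Qed.

Lemma infinite_odd_log_set : infinite_set odd_log_set.
Proof.
apply: infinite_unbounded_count => K; exists (4 ^ K.+1)%N.
have [h _] := odd_log_set_count K.+1; move: h; rewrite expnS.
by have := ltn_expl K (isT : 1 < 4)%N; lia.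
Qed.

Lemma infinite_odd_log_setC : infinite_set (~` odd_log_set).
Proof.
apply: infinite_unbounded_count => K; exists (4 ^ K.+1)%N.
rewrite initial_countC; have [h _] := odd_log_set_count K.+1; move: h; rewrite expnS.
by have := ltn_expl K (isT : 1 < 4)%N; lia.
Qed.

(** The counting function is the integer part of [g n = r n + (1/2 - r) sqrt n].
    The first term fixes the density.  The second is negligible against [n] but
    keeps both [g n] and [n - g n] above [sqrt n / 2], so that the set is infinite
    and coinfinite even for [r] equal to 0 or 1; and [g] still increases by
    at most one at each step. *)
Lemma exists_density_limit (r : R) : 0 <= r <= 1 ->
  exists B, [/\ infinite_set B, infinite_set (~` B) &
    density_ratio R B @ \oo --> r].
Proof.
move=> /andP[r0 r1].
pose s n : R := Num.sqrt n%:R.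
have s0 n : 0 <= s n by exact: sqrtr_ge0.
have ss n : s n * s n = n%:R by rewrite -expr2 sqr_sqrtr.
have sle n : s n <= n%:R.
  case: n => [|n]; first by rewrite /s sqrtr0.
  rewrite -[leLHS]mulr1 -(ss n.+1) ler_pM2l ?sqrtr_gt0 ?ltr0n//.
  by rewrite -[leLHS]sqrtr1 ler_wsqrtr// ler1n.
have sS n : s n <= s n.+1 <= s n + 1.
  rewrite ler_wsqrtr ?ler_nat//= -[s n + 1]ger0_norm ?addr_ge0//.
  rewrite -sqrtr_sqr ler_wsqrtr// sqrrD1 expr2 ss -addn1 natrD.
  have := s0 n; lra.
pose g n := r * n%:R + (2^-1 - r) * s n.
have gE n : g n = r * (n%:R - s n) + s n / 2 by rewrite /g; lra.
have g_lo n : s n / 2 <= g n by rewrite gE lerDr mulr_ge0// subr_ge0.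
have g_hi n : g n <= n%:R - s n / 2.
  have : 0 <= (1 - r) * (n%:R - s n) by rewrite mulr_ge0// subr_ge0.
  by rewrite gE; lra.
have g0 n : 0 <= g n by apply: le_trans (g_lo n); rewrite divr_ge0.
have gS n : g n <= g n.+1 <= g n + 1.
  have /andP[s1 s2] := sS n; rewrite /g -[n.+1%:R]natr1.
  have := mulr_ge0 r0 (_ : 0 <= 1 - (s n.+1 - s n)).
  have := mulr_ge0 (_ : 0 <= 1 - r) (_ : 0 <= 1 - (s n.+1 - s n)).
  by move=> /(_ ltac:(lra) ltac:(lra)) h1 /(_ ltac:(lra)) h2; apply/andP; split; lra.
pose t n := Num.truncn (g n).
have tP n : (t n)%:R <= g n < (t n)%:R + 1.
  by rewrite natr1; exact: truncn_itv.
have t_step i : (t i <= t i.+1 <= (t i).+1)%N.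
  have /andP[gl gr] := gS i; rewrite le_truncn//= -ltnS truncn_lt_nat//.
  by have /andP[_] := tP i; rewrite -!natr1; lra.
have t0 : t 0%N = 0%N by rewrite /t /g /s sqrtr0 !mulr0 addr0 truncn0.
have tcount n := initial_count_step n t0 t_step.
have s_big (K : nat) : K%:R <= s (K * K)%N.
  by rewrite /s natrM -expr2 sqrtr_sqr ler_norm.
exists [set i | (t i < t i.+1)%N]; split.
- apply: infinite_unbounded_count => K; exists ((2 * K) * (2 * K))%N.
  rewrite tcount truncn_ge_nat//; apply: le_trans (g_lo _).
  by have := s_big (2 * K)%N; rewrite natrM; lra.
- apply: infinite_unbounded_count => K; exists ((2 * K) * (2 * K))%N.
  rewrite initial_countC tcount.
  set n := (2 * K * (2 * K))%N; have := s_big (2 * K)%N; rewrite -/n natrM => sn.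
  have : (K + t n <= n)%N.
    by rewrite -(ler_nat R) natrD; have := g_hi n; have /andP[+ _] := tP n; lra.
  lia.
- apply/cvgrPdist_le => e e0; near=> n.
  have n1 : 1 <= n%:R :> R by rewrite ler1n; near: n; exists 1%N.
  have n0 : 0 < n%:R :> R by lra.
  rewrite density_ratioE tcount -[r in r - _](mulfK (lt0r_neq0 n0)) -mulrBl normrM.
  rewrite [ `|_^-1| ]gtr0_norm ?invr_gt0// ler_pdivrMr//.
  pose K := (Num.truncn (2 / e)).+1.
  have Ke : 2 <= e * K%:R.
    by rewrite mulrC -ler_pdivrMr//; apply/ltW/truncnS_gt.
  have Ks : K%:R <= s n.
    apply: le_trans (s_big K) _; rewrite ler_wsqrtr// ler_nat.
    by near: n; exists (K * K)%N.
  have s1 : 1 <= s n by apply: le_trans Ks; rewrite ler1n.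
  have es : 2 * s n <= e * n%:R.
    rewrite -[n%:R]ss mulrA ler_wpM2r//; apply: le_trans Ke _.
    by rewrite ler_wpM2l// ltW.
  have := mulr_ge0 r0 (s0 n); have : 0 <= (1 - r) * s n by rewrite mulr_ge0// subr_ge0.
  move=> h1 h2; have := tP n; rewrite /g => /andP[t1 t2].
  by rewrite ler_norml; apply/andP; split; lra.
Unshelve. all: by end_near.
Qed.

(** The last clause is what the reduction needs of its base set: for a real value,
    no shuffle changes the density.  For [Osc] this may fail, and only generic
    shuffles keep the value. *)
Lemma exists_density_base (v : dval R) : dall v ->
  exists B, [/\ infinite_set B, infinite_set (~` B), density R B = v &
    v = Osc \/ forall x, density R (shuffle x B) = v].
Proof.
case=> [[r /=] + <-|->].
  rewrite in_itv /= => /exists_density_limit[B [Bi Bci Br]].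
  exists B; split=> //; first exact: density_cvg.
  by right=> x; apply: density_cvg; exact: cvg_ratio_shuffle.
exists odd_log_set; split; [exact: infinite_odd_log_set|
  exact: infinite_odd_log_setC|exact: density_odd_log_set|by left].
Qed.

End Existence.

(** * Permutations between infinite-coinfinite sets *)

Lemma infinite_bij (A B : set nat) : infinite_set A -> infinite_set B ->
  exists f, set_bij A B f.
Proof.
move=> Ai Bi; apply/card_set_bijP.
apply: (@card_eq_trans _ _ _ _ [set: nat]); last rewrite card_eq_sym.
  by apply: eq_card_nat => //; exact: countableP.
by apply: eq_card_nat => //; exact: countableP.
Qed.

Lemma permutation_onto (A B : set nat) :
  infinite_set A -> infinite_set (~` A) -> infinite_set B -> infinite_set (~` B) ->
  exists2 p : nat -> nat, bijective p & p @` A = B.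
Proof.
move=> Ai Aci Bi Bci.
have [f [fAB finj fsurj]] := infinite_bij Ai Bi.
have [g [gAB ginj gsurj]] := infinite_bij Aci Bci.
pose p i := if i \in A then f i else g i.
have pA i : A i -> p i = f i by rewrite /p => Ai'; rewrite mem_set.
have pC i : ~ A i -> p i = g i by rewrite /p => Ai'; rewrite memNset.
have pB i : B (p i) <-> A i.
  split=> [|Ai']; last by rewrite pA//; exact: fAB.
  by apply: contraPP => Ai'; rewrite pC//; exact: (gAB i).
exists p.
  rewrite -setTT_bijective; split=> //; last first.
    move=> b _; have [Bb|Bb] := pselect (B b).
      by have [a Aa <-] := fsurj b Bb; exists a => //; exact: pA.
    by have [a Aa <-] := gsurj b Bb; exists a => //; exact: pC.
  move=> i j _ _ pij; have [Ai'|Ai'] := pselect (A i).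
    have Aj : A j by apply/pB; rewrite -pij; apply/pB.
    by apply: finj; rewrite ?inE//; rewrite -!pA.
  have Aj : ~ A j by move=> Aj; apply: Ai'; apply/pB; rewrite pij; apply/pB.
  by apply: ginj; rewrite ?inE//; rewrite -!pC.
rewrite eqEsubset; split=> [_ [i Ai' <-]|b Bb]; first exact/pB.
by have [a Aa <-] := fsurj b Bb; exists a => //; exact: pA.
Qed.

(** * The Tukey reduction *)

Theorem theorem22 (R : realType) (X Y : set (dval R))
    (HX : X `<=` dall) (HY : Y `<=` dall)
    (X0 : X !=set0)
    (HXY : forall x, X x -> exists y, Y y /\ y <> x)
    (Hosc : X Osc \/ ~ Y Osc) :
  [/\ relational_system cantor_meager,
      relational_system (density_system X Y) &
      tukey_le cantor_meager (density_system X Y)].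
Proof.
have tukey : tukey_le cantor_meager (density_system X Y).
  have [v [Xv v_osc]] : exists v, X v /\ (v = Osc \/ ~ Y Osc).
    case: Hosc => [XO|YO]; first by exists Osc; split => //; left.
    by have [v Xv] := X0; exists v; split => //; right.
  have [B [Bi Bci Bv Bx]] := exists_density_base (HX _ Xv).
  have BD : dsets X B by split; rewrite ?Bv.
  (* For [v = Osc] a shuffle may have a density outside [X], though only for [x] in
     a meager set; there [B] serves instead. *)
  pose phim (x : cantor_space) : set nat :=
    if shuffle x B \in dsets X then shuffle x B else B.
  have phimP x : dsets X (phim x).
    by rewrite /phim; case: ifP => // /set_mem.
  pose esc p := [set x : cantor_space |
    ~ (lower_density R (p @` shuffle x B) <= lower_density R B /\
       upper_density R B <= upper_density R (p @` shuffle x B))].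
  have escE p x : ~ esc p x ->
      density R (p @` shuffle x B) = v \/ density R (p @` shuffle x B) = Osc.
    by move=> /contrapT[l u]; rewrite -Bv; exact: density_squeezed.
  have capture p : bijective p ->
      meager [set x | rearranges Y (phim x) p].
    (* Genericity with respect to [p] controls the density after the rearrangement,
       with respect to [id] that of the shuffle itself. *)
    move=> bp; apply: (meager_subset (B := \bigcup_b esc (if b then p else id))).
      move=> x [Yp ne]; apply: contrapT => no.
      have np : ~ esc p x by move=> h; apply: no; exists true.
      have nid : ~ esc id x by move=> h; apply: no; exists false.
      have xv : density R (shuffle x B) = v.
        case: Bx => [vO|->//]; have := escE _ _ nid; by rewrite image_id vO => -[].
      have phimE : phim x = shuffle x B.
        rewrite /phim mem_set//; split; rewrite ?xv//; first exact: infinite_shuffle.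
        exact: (infinite_shuffle (B := ~` B)).
      rewrite phimE in Yp ne; case: (escE _ _ np) => pv.
        by apply: ne; rewrite pv xv.
      case: v_osc => [vO|]; first by apply: ne; rewrite pv xv.
      by apply; rewrite -pv.
    apply: meager_bigcup => -[|]; apply: meager_density_escape => //.
    by exists id.
  exists (fun x => SigSub (mem_set (phimP x))),
    (fun p => SigSub (mem_set (capture _ (set_valP p)))) => x p /=.
  by [].
split=> //; first exact: cantor_meager_relational.
split=> [[A AD]|p] /=.
  have [Ai Aci XA] := set_mem AD.
  have [y [Yy yA]] := HXY _ XA.
  have [B [Bi Bci By _]] := exists_density_base (HY _ Yy).
  have [p bp pAB] := permutation_onto Ai Aci Bi Bci.
  by exists (SigSub (mem_set bp)); rewrite /rearranges /= pAB By.
have [phim [phip phiP]] := tukey.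
have [x xp] := cantor_meager_relational.2 (phip p).
by exists (phim x) => /phiP.
Qed.
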